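(* Let $O=\{o_1,\ldots,o_k\}$ be a finite set equipped with a linear order $\succ$, and let $\mathcal{A}=\{A_1,\ldots,A_m\}$ and $\mathcal{B}=\{B_1,\ldots,B_n\}$ be dual multi-hypergraphs on the ground set $O$. Let $A^0\in\mathcal{A}$ be a lexmax edge of $\mathcal{A}$, i.e. an edge such that $A^0\succeq_L A$ for every $A\in\mathcal{A}$. Then $A^0$ is a minimal edge of $\mathcal{A}$. Furthermore, for every $o^0\in A^0$ there exists a minimal edge $B^0\in\mathcal{B}$ such that $A^0\cap B^0=\{o^0\}$ and $o^0\succeq o$ for each $o\in B^0$.
   Context: A multi-hypergraph on $O$ is a finite list of subsets of $O$ (its edges), where equal edges and edges contained in one another are allowed. An edge is (containment) minimal if it is not a strict superset of another edge of the same multi-hypergraph. Multi-hypergraphs $\mathcal{A}$ and $\mathcal{B}$ on $O$ are dual if (i) $A\cap B\neq\emptyset$ for every $A\in\mathcal{A}$ and $B\in\mathcal{B}$, and (ii) for every $B^T\subseteq O$ with $B^T\cap B\neq\emptyset$ for all $B\in\mathcal{B}$, there exists $A\in\mathcal{A}$ with $A\subseteq B^T$. The lexicographic order $\succ_L$ on $2^O$ induced by $\succ$ is defined as follows: for distinct $O',O''\subseteq O$, let $o$ be the $\succ$-minimum element of the symmetric difference $(O'\setminus O'')\cup(O''\setminus O')$; if $o\in O'\setminus O''$ then $O''\succ_L O'$, and if $o\in O''\setminus O'$ then $O'\succ_L O''$. (Equivalently, if $o_1\prec\cdots\prec o_k$ and $w(o_i)=-2^{k-i}$, $w(U)=\sum_{o\in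 U}w(o)$, then $O'\succ_L O''$ iff $w(O')>w(O'')$.) *)

(* Defs.v *)
From HB Require Import structures.
From mathcomp Require Export all_boot all_order.
Set Implicit Arguments.
Unset Strict Implicit.
Unset Printing Implicit Defensive.

(* Repetitions in the list are allowed, as are edges included in one another
   and the empty list. *)
Definition multi_hypergraph (T : finType) := seq {set T}.

Definition minimal_edge (T : finType) (H : multi_hypergraph T) (X : {set T}) :
    bool :=
  (X \in H) && all (fun Y : {set T} => ~~ (Y \proper X)) H.

Definition dual (T : finType) (HA HB : multi_hypergraph T) : Prop :=
  (forall A B : {set T}, A \in HA -> B \in HB -> A :&: B != set0) /\
  (forall S : {set T}, (forall B : {set T}, B \in HB -> S :&: B != set0) ->
     exists2 A : {set T}, A \in HA & A \subset S).

Definition symdiff (T : finType) (X Y : {set T}) : {set T} :=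
  (X :\: Y) :|: (Y :\: X).

(* The set that contains the least element of the symmetric difference is the
   smaller one.  X != Y is implied, since such an element must exist. *)
Definition lex_gt (d : Order.disp_t) (T : finOrderType d) (X Y : {set T}) :
    bool :=
  [exists o in Y :\: X, [forall o' in symdiff X Y, (o <= o')%O]].

Definition lex_ge (d : Order.disp_t) (T : finOrderType d) (X Y : {set T}) :
    bool :=
  (X == Y) || lex_gt X Y.

Definition lexmax_edge (d : Order.disp_t) (T : finOrderType d)
    (H : multi_hypergraph T) (X : {set T}) : Prop :=
  X \in H /\ (forall Y : {set T}, Y \in H -> lex_ge X Y).

(* Main.v *)
(** Fix [o0] in the lexmax edge [A0] and let
    [S := (A0 \ {o0}) ∪ {o | o0 < o}].  An edge [A] of [HA] inside [S] would beat
    [A0]: it misses [o0], and every element of [A \ A0] is above [o0], so the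
    least element of the symmetric difference lies in [A0].  By duality [S]
    is therefore not a transversal of [HB], and any inclusion-minimal edge of
    [HB] disjoint from [S] is the desired [B0]. *)
Require Import Defs.
Import Order.TTheory.

(** If [Y] is a strict subset of [X], then [Y :\: X] is empty, whereas [lex_gt X Y] needs an element
    there. *)
Lemma lexmax_edge_minimal (d : Order.disp_t) (O : finOrderType d)
    (H : multi_hypergraph O) (X : {set O}) :
  lexmax_edge H X -> minimal_edge H X.
Proof.
case=> XH Xmax; rewrite /minimal_edge XH; apply/allP => Y YH.
apply/negP => /properP [sYX [x xX xNY]].
case/orP: (Xmax Y YH) => [/eqP eXY|]; first by rewrite -eXY xX in xNY.
case/existsP=> o /andP [/setDP [oY /negP oNX] _].
exact: oNX (subsetP sYX o oY).
Qed.

Lemma lex_ge_notin (d : Order.disp_t) (T : finOrderType d) (X Y : {set T})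
    (x : T) :
  lex_ge X Y -> x \in X -> x \notin Y ->
  exists2 o, o \in Y :\: X & (o <= x)%O.
Proof.
move=> geXY xX xNY; case/orP: geXY => [/eqP eXY|].
  by rewrite -eXY xX in xNY.
case/existsP=> o /andP [oYX /forallP omin]; exists o => //.
by have /implyP := omin x; apply; rewrite !inE xX xNY.
Qed.

Lemma dual_disjoint_edge (T : finType) (HA HB : multi_hypergraph T)
    (S : {set T}) :
  dual HA HB -> (forall A : {set T}, A \in HA -> ~~ (A \subset S)) ->
  exists2 B : {set T}, minimal_edge HB B & [disjoint S & B].
Proof.
case=> _ transv noA.
pose P := [pred B : {set T} | (B \in HB) && [disjoint S & B]].
have [/hasP [B BH SB]|/hasPn hits] :=
  boolP (has (fun B : {set T} => [disjoint S & B]) HB).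
  have PB : P B by rewrite /= BH SB.
  have [M /minsetP [/andP [MH SM] Mmin] _] := minset_exists PB.
  exists M => //; rewrite /minimal_edge MH; apply/allP => Y YH.
  apply/negP => pYM; have sYM := proper_sub pYM.
  (* An edge inside [M] is again disjoint from [S], so minimality among the edges disjoint from [S]
     gives minimality in all of [HB]. *)
  have eYM : Y = M by apply: Mmin => //=; rewrite YH (disjointWr sYM SM).
  by rewrite eYM properxx in pYM.
have [B BH|A AH sAS] := transv S; first by rewrite setI_eq0 hits.
by have := noA A AH; rewrite sAS.
Qed.

Theorem theorem1 (d : Order.disp_t) (O : finOrderType d)
    (HA HB : multi_hypergraph O) (hdual : dual HA HB)
    (A0 : {set O}) (hA0 : lexmax_edge HA A0) :
  minimal_edge HA A0 /\
  (forall o0 : O, o0 \in A0 ->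
     exists B0 : {set O},
       [/\ minimal_edge HB B0,
           A0 :&: B0 = [set o0] &
           forall o : O, o \in B0 -> (o <= o0)%O]).
Proof.
split; first exact: lexmax_edge_minimal.
case: hA0 => A0H A0max o0 o0A0.
pose S := (A0 :\ o0) :|: [set o | (o0 < o)%O].
have noA (A : {set O}) : A \in HA -> ~~ (A \subset S).
  move=> AH; apply/negP => /subsetP sAS.
  have o0NA : o0 \notin A.
    by apply/negP => /sAS; rewrite !inE eqxx ltxx.
  (* This [o] is outside [A0] and not above [o0], so it lies in neither part of [S]. *)
  have [o /setDP [oA oNA0] leo] := lex_ge_notin _ _ _ _ _ (A0max A AH) o0A0 o0NA.
  by have := sAS o oA; rewrite !inE (negPf oNA0) andbF ltNge leo.
have [B Bmin SB] := dual_disjoint_edge _ _ _ _ hdual noA.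
have BH : B \in HB by case/andP: Bmin.
have BNS o : o \in B -> o \notin S by move=> oB; rewrite (disjointFl SB oB).
have sub1 o : o \in A0 :&: B -> o = o0.
  case/setIP=> oA0 /BNS; rewrite !inE oA0 andbT negb_or negbK.
  by case/andP=> /eqP.
exists B; split=> // [|o /BNS].
  (* The intersection half of duality makes [A0 :&: B] nonempty, and by [sub1] its only possible
     element is [o0]. *)
  have /set0Pn [x xAB] := hdual.1 A0 B A0H BH.
  apply/setP => o; rewrite in_set1; apply/idP/eqP => [/sub1 //|->].
  by rewrite -(sub1 x xAB).
by rewrite !inE negb_or -leNgt => /andP [].
Qed.
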